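(* Assume that $q^4\ne1$. Then the following relations hold in $U_q(\mathfrak{sl}_2)$: \begin{align*} (q+q^{-1})\nu_x &= q^2 + q^{-2} - \frac{q^4 y^2 z^2 - q^{-4}z^2y^2}{q^2-q^{-2}},\\ (q+q^{-1})\nu_y &= q^2 + q^{-2} - \frac{q^4 z^2 x^2 - q^{-4}x^2z^2}{q^2-q^{-2}},\\ (q+q^{-1})\nu_z &= q^2 + q^{-2} - \frac{q^4 x^2 y^2 - q^{-4}y^2x^2}{q^2-q^{-2}}. \end{align*}
   Context: $\mathbb K$ is a field and $q$ is a nonzero scalar in $\mathbb K$ with $q^2\neq 1$. $U_q(\mathfrak{sl}_2)$ is the unital associative $\mathbb K$-algebra with generators $x,y,y^{-1},z$ and relations $yy^{-1}=y^{-1}y=1$, $\frac{qxy-q^{-1}yx}{q-q^{-1}}=1$, $\frac{qyz-q^{-1}zy}{q-q^{-1}}=1$, $\frac{qzx-q^{-1}xz}{q-q^{-1}}=1$. In $U_q(\mathfrak{sl}_2)$: $\nu_x=q(1-yz)=q^{-1}(1-zy)$, $\nu_y=q(1-zx)=q^{-1}(1-xz)$, $\nu_z=q(1-xy)=q^{-1}(1-yx)$. *)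

(* Defs.v *)
From HB Require Import structures.
From mathcomp Require Import all_boot all_order all_algebra.
From mathcomp Require Import generic_quotient ring_quotient.
From mathcomp Require Import boolp.
From mathcomp Require Import finmap monalg.

Set Implicit Arguments.
Unset Strict Implicit.
Unset Printing Implicit Defensive.

Import GRing.Theory.

Local Open Scope ring_scope.
Local Open Scope quotient_scope.

Inductive ideal_gen (A : nzRingType) (S : A -> Prop) : A -> Prop :=
| ideal_gen_in a : S a -> ideal_gen S a
| ideal_gen0 : ideal_gen S 0
| ideal_genB a b : ideal_gen S a -> ideal_gen S b -> ideal_gen S (a - b)
| ideal_genMl a b : ideal_gen S b -> ideal_gen S (a * b)
| ideal_genMr a b : ideal_gen S a -> ideal_gen S (a * b).

Section IdealPred.
Variables (A : nzRingType) (S : A -> Prop).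

Definition ideal_pred : {pred A} := fun a => `[< ideal_gen S a >].

Lemma ideal_pred_zmod_closed : zmod_closed ideal_pred.
Proof.
split=> [|a b /asboolP ia /asboolP ib]; apply/asboolP.
  exact: ideal_gen0.
exact: ideal_genB.
Qed.

HB.instance Definition _ :=
  GRing.isZmodClosed.Build A ideal_pred ideal_pred_zmod_closed.

Lemma ideal_genD a b : ideal_gen S a -> ideal_gen S b -> ideal_gen S (a + b).
Proof.
move=> ia ib; rewrite -[b]opprK; apply: ideal_genB => //.
by rewrite -[- b]add0r; apply: ideal_genB => //; exact: ideal_gen0.
Qed.

End IdealPred.

Lemma ideal_genZ (K : fieldType) (A : lalgType K) (S : A -> Prop) (c : K) a :
  ideal_gen S a -> ideal_gen S (c *: a).
Proof. by move=> ia; rewrite -[a]mul1r scalerAl; apply: ideal_genMl. Qed.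

(* The quotient of A by the two-sided ideal generated by S; properness of the
   ideal is a parameter because algType requires a nonzero ring. *)
Definition alg_quot (K : fieldType) (A : algType K) (S : A -> Prop)
    (S_proper : ~ ideal_gen S 1) : Type :=
  Quotient.quot (ideal_pred S).

Section AlgQuotient.
Variables (K : fieldType) (A : algType K) (S : A -> Prop).
Hypothesis S_proper : ~ ideal_gen S 1.

Local Notation Q := (alg_quot S_proper).

HB.instance Definition _ := GRing.Zmodule.on Q.
HB.instance Definition _ := EqQuotient.on Q.

Implicit Types (u v w : Q) (a b : A) (c : K).

Definition qpi (a : A) : Q := \pi_Q a.
Definition qone : Q := qpi 1.
Definition qmul u v : Q := qpi (repr u * repr v).
Definition qscale c u : Q := qpi (c *: repr u).

Lemma qpiP a b : reflect (qpi a = qpi b) `[< ideal_gen S (a - b) >].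
Proof.
have := Quotient.idealrBE (ideal_pred S) a b.
rewrite /in_mem /= /ideal_pred => ->; exact: eqP.
Qed.

Lemma qpi_repr u : qpi (repr u) = u.
Proof. exact: reprK. Qed.

Lemma qrepr_pi a : ideal_gen S (repr (qpi a) - a).
Proof. by apply/asboolP/qpiP; rewrite qpi_repr. Qed.

Lemma qpiD a b : qpi (a + b) = qpi a + qpi b.
Proof. exact: Quotient.pi_add. Qed.

Lemma qpi0 : qpi 0 = 0.
Proof. by apply: (addrI (qpi 0)); rewrite -qpiD !addr0. Qed.

Lemma qpiM a b : qpi (a * b) = qmul (qpi a) (qpi b).
Proof.
symmetry; apply/qpiP/asboolP; set a' := repr _; set b' := repr _.
rewrite -[a' * b'](subrK (a' * b)) -mulrBr -addrA -mulrBl.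
by apply: ideal_genD; [apply: ideal_genMl|apply: ideal_genMr]; apply: qrepr_pi.
Qed.

Lemma qpiZ c a : qpi (c *: a) = qscale c (qpi a).
Proof.
symmetry; apply/qpiP/asboolP; rewrite -scalerBr.
exact/ideal_genZ/qrepr_pi.
Qed.

Lemma qmulA : associative qmul.
Proof.
move=> u v w; rewrite -[u]qpi_repr -[v]qpi_repr -[w]qpi_repr.
by rewrite -!qpiM mulrA.
Qed.

Lemma qmul1 : left_id qone qmul.
Proof. by move=> u; rewrite -[u]qpi_repr -qpiM mul1r. Qed.

Lemma qmulr1 : right_id qone qmul.
Proof. by move=> u; rewrite -[u]qpi_repr -qpiM mulr1. Qed.

Lemma qmulDl : left_distributive qmul +%R.
Proof.
move=> u v w; rewrite -[u]qpi_repr -[v]qpi_repr -[w]qpi_repr.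
by rewrite -!qpiM -!qpiD -qpiM mulrDl.
Qed.

Lemma qmulDr : right_distributive qmul +%R.
Proof.
move=> u v w; rewrite -[u]qpi_repr -[v]qpi_repr -[w]qpi_repr.
by rewrite -!qpiM -!qpiD -qpiM mulrDr.
Qed.

Lemma qone_neq0 : qone != 0.
Proof. by apply/eqP; rewrite -qpi0 => /qpiP/asboolP; rewrite subr0. Qed.

HB.instance Definition _ := GRing.Zmodule_isNzRing.Build Q
  qmulA qmul1 qmulr1 qmulDl qmulDr qone_neq0.

Lemma qscaleA c d u : qscale c (qscale d u) = qscale (c * d) u.
Proof. by rewrite -[u]qpi_repr -!qpiZ scalerA. Qed.

Lemma qscale1 : left_id 1 qscale.
Proof. by move=> u; rewrite -[u]qpi_repr -qpiZ scale1r. Qed.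

Lemma qscaleDr : right_distributive qscale +%R.
Proof.
move=> c u v; rewrite -[u]qpi_repr -[v]qpi_repr.
by rewrite -!qpiZ -!qpiD -qpiZ scalerDr.
Qed.

Lemma qscaleDl u : {morph qscale^~ u : c d / c + d}.
Proof. by move=> c d; rewrite -[u]qpi_repr -!qpiZ -qpiD scalerDl. Qed.

HB.instance Definition _ := GRing.Zmodule_isLmodule.Build K Q
  qscaleA qscale1 qscaleDr qscaleDl.

Lemma qscaleAl c u v : c *: (u * v) = (c *: u) * v.
Proof.
rewrite -[u]qpi_repr -[v]qpi_repr; change (qscale c (qmul (qpi (repr u))
  (qpi (repr v))) = qmul (qscale c (qpi (repr u))) (qpi (repr v))).
by rewrite -!(qpiM, qpiZ) scalerAl.
Qed.

HB.instance Definition _ := GRing.Lmodule_isLalgebra.Build K Q qscaleAl.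

Lemma qscaleAr c u v : c *: (u * v) = u * (c *: v).
Proof.
rewrite -[u]qpi_repr -[v]qpi_repr; change (qscale c (qmul (qpi (repr u))
  (qpi (repr v))) = qmul (qpi (repr u)) (qscale c (qpi (repr v)))).
by rewrite -!(qpiM, qpiZ) scalerAr.
Qed.

HB.instance Definition _ := GRing.Lalgebra_isAlgebra.Build K Q qscaleAr.

Lemma qpi_is_linear : linear qpi.
Proof. by move=> c a b; rewrite qpiD qpiZ. Qed.

HB.instance Definition _ :=
  GRing.isLinear.Build K A Q *:%R qpi qpi_is_linear.

Lemma qpi_is_monoid_morphism : monoid_morphism qpi.
Proof. by split=> // a b; rewrite qpiM. Qed.

HB.instance Definition _ :=
  GRing.isMonoidMorphism.Build A Q qpi qpi_is_monoid_morphism.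

Lemma qpi_gen a : S a -> qpi a = 0.
Proof.
move=> Sa; rewrite -qpi0; apply/qpiP/asboolP; rewrite subr0.
exact: ideal_gen_in.
Qed.

End AlgQuotient.

Lemma malg_scalerAr (M : monomType) (K : comNzRingType) (c : K)
    (a b : {malg K[M]}) :
  c *: (a * b) = a * (c *: b).
Proof.
apply/malgP => k; rewrite mcoeffZ mcoeffMl.
rewrite (mcoeffMlw k (fsubset_refl _) (msuppZ_le c b)) mulr_sumr.
apply: eq_bigr => i _; rewrite mulr_sumr; apply: eq_bigr => j _.
by rewrite mcoeffZ mulrnAr mulrCA.
Qed.

(* The free unital associative K-algebra on four noncommuting generators, i.e.
   the monoid algebra of the free monoid on 'I_4. *)
Definition free_alg (K : fieldType) : Type := {malg K[{fmonom 'I_4}]}.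

HB.instance Definition _ (K : fieldType) := GRing.Lalgebra.on (free_alg K).

HB.instance Definition _ (K : fieldType) :=
  GRing.Lalgebra_isAlgebra.Build K (free_alg K) (@malg_scalerAr _ K).

Definition free_gen (K : fieldType) (i : 'I_4) : free_alg K :=
  mkmalgU (fmu i) 1.

(* The defining relations, each written as (left-hand side) - (right-hand side);
   y' stands for the generator y^-1. *)
Inductive relator (K : fieldType) (q : K) (A : algType K) (x y y' z : A) :
    A -> Prop :=
| relator_yy' : relator q x y y' z (y * y' - 1)
| relator_y'y : relator q x y y' z (y' * y - 1)
| relator_xy : relator q x y y' z
    ((q - q^-1)^-1 *: (q *: (x * y) - q^-1 *: (y * x)) - 1)
| relator_yz : relator q x y y' z
    ((q - q^-1)^-1 *: (q *: (y * z) - q^-1 *: (z * y)) - 1)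
| relator_zx : relator q x y y' z
    ((q - q^-1)^-1 *: (q *: (z * x) - q^-1 *: (x * z)) - 1).

Definition Uq_relator (K : fieldType) (q : K) : free_alg K -> Prop :=
  relator q (free_gen K (inord 0)) (free_gen K (inord 1))
            (free_gen K (inord 2)) (free_gen K (inord 3)).

Section Augmentation.
Variables (K : fieldType) (q : K).

Definition one_mmorph (_ : {fmonom 'I_4}) : K := 1.

Lemma one_mmorph_subproof : mmorphism one_mmorph.
Proof. by split=> // a b; rewrite /one_mmorph mulr1. Qed.

HB.instance Definition _ :=
  isMultiplicative.Build {fmonom 'I_4} K one_mmorph one_mmorph_subproof.

Lemma free_aug_exists : exists f : {rmorphism free_alg K -> K},
  (forall c a, f (c *: a) = c * f a) /\ (forall i, f (free_gen K i) = 1).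
Proof.
exists (mmap idfun one_mmorph : {rmorphism {malg K[{fmonom 'I_4}]} -> K}).
split=> [c a|i]; first exact: mmap_is_linear.
by rewrite /= mmapU mulr1.
Qed.

Lemma qdiff_neq0 : q != 0 -> q ^+ 2 != 1 -> q - q^-1 != 0.
Proof.
move=> q0; apply: contra; rewrite subr_eq0 => /eqP qV.
by rewrite expr2 {2}qV divff.
Qed.

Lemma relator_proper (A : algType K) (x y y' z : A) (f : {rmorphism A -> K}) :
    q - q^-1 != 0 -> (forall c u, f (c *: u) = c * f u) ->
    f x = 1 -> f y = 1 -> f y' = 1 -> f z = 1 ->
  ~ ideal_gen (relator q x y y' z) 1.
Proof.
move=> qd fZ fx fy fy' fz.
suff f0 a : ideal_gen (relator q x y y' z) a -> f a = 0.
  by move/f0/eqP; rewrite rmorph1 oner_eq0.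
elim=> {a} [_ [] | |a b _ Ha _ Hb|a b _ Hb|a b _ Ha].
1,2: by rewrite rmorphB rmorph1 rmorphM fy fy' mulr1 subrr.
1-3: by rewrite rmorphB rmorph1 fZ rmorphB !fZ !rmorphM ?fx ?fy ?fz !mulr1 mulVf
                ?subrr.
- exact: rmorph0.
- by rewrite rmorphB Ha Hb subr0.
- by rewrite rmorphM Hb mulr0.
- by rewrite rmorphM Ha mul0r.
Qed.

(* Sending every generator to 1 satisfies the relations. *)
Lemma Uq_relator_proper :
  q != 0 -> q ^+ 2 != 1 -> ~ ideal_gen (Uq_relator q) 1.
Proof.
move=> q0 q1; have [f [fZ fX]] := free_aug_exists.
by apply: (relator_proper (f := f)) => //; apply: qdiff_neq0.
Qed.

End Augmentation.

Definition Uqsl2 (K : fieldType) (q : K) (q_neq0 : q != 0)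
    (q2_neq1 : q ^+ 2 != 1) : algType K :=
  alg_quot (Uq_relator_proper q_neq0 q2_neq1).

Lemma relator_inverse (K : fieldType) (A B : algType K) (f : {lrmorphism A -> B})
    (a b : A) :
  f (a * b - 1) = 0 -> f a * f b = 1.
Proof. by rewrite rmorphB rmorph1 rmorphM => /eqP; rewrite subr_eq0 => /eqP. Qed.

Lemma relator_commutator (K : fieldType) (q : K) (A B : algType K)
    (f : {lrmorphism A -> B}) (a b : A) :
  f ((q - q^-1)^-1 *: (q *: (a * b) - q^-1 *: (b * a)) - 1) = 0 ->
  (q - q^-1)^-1 *: (q *: (f a * f b) - q^-1 *: (f b * f a)) = 1.
Proof.
have fM u v : f (u * v) = f u * f v by exact: rmorphM.
have fZ c u : f (c *: u) = c *: f u by exact: linearZ.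
have fB u v : f (u - v) = f u - f v by exact: rmorphB.
rewrite fB rmorph1 fZ fB !fZ !fM => /eqP.
by rewrite subr_eq0 => /eqP.
Qed.

Lemma commutator_nu (K : fieldType) (q : K) (A : algType K) (u v : A) :
    q - q^-1 != 0 ->
    (q - q^-1)^-1 *: (q *: (u * v) - q^-1 *: (v * u)) = 1 ->
  q *: (1 - u * v) = q^-1 *: (1 - v * u).
Proof.
move=> qd /(congr1 (fun w => (q - q^-1) *: w)).
rewrite scalerA divff // scale1r scalerBl => /eqP.
rewrite subr_eq => /eqP H; rewrite !scalerBr H.
by rewrite opprD opprB addrA [_ + (_ - _)]addrC subrK.
Qed.

Section Generators.
Variables (K : fieldType) (q : K) (q_neq0 : q != 0) (q2_neq1 : q ^+ 2 != 1).

Local Notation Uq := (Uqsl2 q_neq0 q2_neq1).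

Definition Uq_gen (i : 'I_4) : Uq :=
  qpi (Uq_relator_proper q_neq0 q2_neq1) (free_gen K i).

Definition Uq_x : Uq := Uq_gen (inord 0).
Definition Uq_y : Uq := Uq_gen (inord 1).
Definition Uq_yV : Uq := Uq_gen (inord 2).
Definition Uq_z : Uq := Uq_gen (inord 3).

Lemma Uq_yyV : Uq_y * Uq_yV = 1.
Proof. by apply: relator_inverse; apply: qpi_gen; constructor. Qed.

Lemma Uq_yVy : Uq_yV * Uq_y = 1.
Proof. by apply: relator_inverse; apply: qpi_gen; constructor. Qed.

Lemma Uq_xy :
  (q - q^-1)^-1 *: (q *: (Uq_x * Uq_y) - q^-1 *: (Uq_y * Uq_x)) = 1.
Proof. by apply: relator_commutator; apply: qpi_gen; constructor. Qed.

Lemma Uq_yz :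
  (q - q^-1)^-1 *: (q *: (Uq_y * Uq_z) - q^-1 *: (Uq_z * Uq_y)) = 1.
Proof. by apply: relator_commutator; apply: qpi_gen; constructor. Qed.

Lemma Uq_zx :
  (q - q^-1)^-1 *: (q *: (Uq_z * Uq_x) - q^-1 *: (Uq_x * Uq_z)) = 1.
Proof. by apply: relator_commutator; apply: qpi_gen; constructor. Qed.

Definition nu_x : Uq := q *: (1 - Uq_y * Uq_z).
Definition nu_y : Uq := q *: (1 - Uq_z * Uq_x).
Definition nu_z : Uq := q *: (1 - Uq_x * Uq_y).

Lemma nu_xE : nu_x = q^-1 *: (1 - Uq_z * Uq_y).
Proof. exact: commutator_nu (qdiff_neq0 q_neq0 q2_neq1) Uq_yz. Qed.

Lemma nu_yE : nu_y = q^-1 *: (1 - Uq_x * Uq_z).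
Proof. exact: commutator_nu (qdiff_neq0 q_neq0 q2_neq1) Uq_zx. Qed.

Lemma nu_zE : nu_z = q^-1 *: (1 - Uq_y * Uq_x).
Proof. exact: commutator_nu (qdiff_neq0 q_neq0 q2_neq1) Uq_xy. Qed.

End Generators.

(* Main.v *)
Require Import Defs.
From mathcomp Require Import all_boot all_order all_algebra.
From mathcomp Require Import ring.

(** Each of the three relations involves only two generators, say [u] and [v],
    and the element [n] for which [u v = 1 - q^-1 n] and [v u = 1 - q n].
    Computing [u v u] and [v u v] in two ways shows that [n] q-commutes with
    [u] and with [v]: [u n = q^-2 n u] and [v n = q^2 n v].  Pushing [n] to the
    left in [u (u v) v] and in [v (v u) u] then writes both products as
    polynomials in [n] alone:

      [u^2 v^2 = (1 - q^-3 n) (1 - q^-1 n)],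
      [v^2 u^2 = (1 - q^3 n) (1 - q n)].

    In [q^4 u^2 v^2 - q^-4 v^2 u^2] the terms in [n^2] cancel, and both
    remaining coefficients are divisible by [q^2 - q^-2]: the constant term is
    [(q^2 - q^-2) (q^2 + q^-2)] and the coefficient of [n] is
    [- (q^2 - q^-2) (q + q^-1)].  Dividing by [q^2 - q^-2], which is nonzero
    because [q^4 != 1], gives the relation.  Since [x, y, z] are permuted
    cyclically by the defining relations, [sum_inv_scale_nu] applied to
    [(y, z)], [(z, x)] and [(x, y)] gives all three. *)

Set Implicit Arguments.
Unset Strict Implicit.
Unset Printing Implicit Defensive.

Import GRing.Theory.

Local Open Scope ring_scope.

(** Expanding [n] as [q (1 - u v)] in [n u] and as [q^-1 (1 - v u)] in [u n]
    gives [q] and [q^-1] times the same element [u - u v u]. *)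
Lemma nu_qcommute (K : fieldType) (q : K) (A : algType K) (u v n : A) :
    q != 0 -> n = q *: (1 - u * v) -> n = q^-1 *: (1 - v * u) ->
  u * n = q ^- 2 *: (n * u).
Proof.
move=> q0 nE nE'; rewrite {1}nE' {}nE -scalerAr -scalerAl scalerA.
congr (_ *: _); first by field.
by rewrite mulrBr mulrBl mulr1 mul1r mulrA.
Qed.

(** This is the product [(1 - q^-3 n) (1 - q^-1 n)], expanded.  The hypotheses
    are invariant under exchanging [u] and [v] and inverting [q], so the lemma
    also computes [v^2 u^2]. *)
Lemma sqr_mul_nu (K : fieldType) (q : K) (A : algType K) (u v n : A) :
    q != 0 -> n = q *: (1 - u * v) -> n = q^-1 *: (1 - v * u) ->
  u ^+ 2 * v ^+ 2 = 1 - (q^-1 + q ^- 3) *: n + q ^- 4 *: n ^+ 2.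
Proof.
move=> q0 nE nE'; have un := nu_qcommute q0 nE nE'.
have uvE : u * v = 1 - q^-1 *: n.
  by rewrite nE scalerA mulVf // scale1r subKr.
rewrite !expr2 mulrA -(mulrA u) uvE mulrBr mulr1 -scalerAr un scalerA.
rewrite mulrBl uvE -scalerAl -mulrA uvE mulrBr mulr1 -scalerAr.
rewrite scalerBr scalerA opprB addrA addrAC -(addrA 1) -opprD -scalerDl.
by congr (_ - _ *: _ + _ *: _); field.
Qed.

(** The common form of the three relations, for a pair [u], [v] with its
    element [n]; the hypothesis [q^4 != 1] says that [q^2 - q^-2] is
    invertible. *)
Lemma sum_inv_scale_nu (K : fieldType) (q : K) (A : algType K) (u v n : A) :
    q != 0 -> q ^+ 4 != 1 ->
    n = q *: (1 - u * v) -> n = q^-1 *: (1 - v * u) ->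
  (q + q^-1) *: n =
    (q ^+ 2 + q ^- 2)%:A - (q ^+ 2 - q ^- 2)^-1 *:
      (q ^+ 4 *: (u ^+ 2 * v ^+ 2) - q ^- 4 *: (v ^+ 2 * u ^+ 2)).
Proof.
move=> q_neq0 q4 nE nE'; have qV0 : q^-1 != 0 by rewrite invr_eq0.
have d0 : q ^+ 2 - q ^- 2 != 0.
  apply: contra q4; rewrite subr_eq0 => /eqP q2V.
  by rewrite (exprD q 2 2) {1}q2V mulVf // expf_neq0.
rewrite (sqr_mul_nu q_neq0 nE nE') (@sqr_mul_nu _ q^-1 _ v u n) ?invrK //.
have -> : q ^+ 4 *: (1 - (q^-1 + q ^- 3) *: n + q ^- 4 *: n ^+ 2) -
    q ^- 4 *: (1 - (q + q^-1 ^- 3) *: n + q^-1 ^- 4 *: n ^+ 2) =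
    (q ^+ 2 - q ^- 2) *: ((q ^+ 2 + q ^- 2)%:A - (q + q^-1) *: n).
  rewrite !scalerDr !scalerN !scalerA -!exprVn invrK.
  rewrite -exprMn divff // -exprMn mulVf // !expr1n.
  rewrite opprD addrACA subrr addr0 opprD addrACA -scalerBl -opprD -scalerBl.
  by congr (_ *: _ - _ *: _); field.
by rewrite scalerA mulVf // scale1r subKr.
Qed.

Theorem lemma3p8 (K : fieldType) (q : K) (q_neq0 : q != 0)
    (q2_neq1 : q ^+ 2 != 1) (q4_neq1 : q ^+ 4 != 1) :
  let x := Uq_x q_neq0 q2_neq1 in
  let y := Uq_y q_neq0 q2_neq1 in
  let z := Uq_z q_neq0 q2_neq1 in
  [/\ (q + q^-1) *: nu_x q_neq0 q2_neq1 =
        (q ^+ 2 + q ^- 2)%:A - (q ^+ 2 - q ^- 2)^-1 *: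
          (q ^+ 4 *: (y ^+ 2 * z ^+ 2) - q ^- 4 *: (z ^+ 2 * y ^+ 2)),
      (q + q^-1) *: nu_y q_neq0 q2_neq1 =
        (q ^+ 2 + q ^- 2)%:A - (q ^+ 2 - q ^- 2)^-1 *:
          (q ^+ 4 *: (z ^+ 2 * x ^+ 2) - q ^- 4 *: (x ^+ 2 * z ^+ 2)) &
      (q + q^-1) *: nu_z q_neq0 q2_neq1 =
        (q ^+ 2 + q ^- 2)%:A - (q ^+ 2 - q ^- 2)^-1 *:
          (q ^+ 4 *: (x ^+ 2 * y ^+ 2) - q ^- 4 *: (y ^+ 2 * x ^+ 2))].
Proof.
move=> x y z; split.
- exact: (sum_inv_scale_nu q_neq0 q4_neq1 (erefl _) (nu_xE q_neq0 q2_neq1)).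
- exact: (sum_inv_scale_nu q_neq0 q4_neq1 (erefl _) (nu_yE q_neq0 q2_neq1)).
- exact: (sum_inv_scale_nu q_neq0 q4_neq1 (erefl _) (nu_zE q_neq0 q2_neq1)).
Qed.
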